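(* Let $\alpha$ be a holomorphic $1$-form on $\mathbb{C}^4\setminus\{0\}$ associated with a codimension one holomorphic foliation of degree $2$ on $\mathbb{CP}^3$, and let $w$ be the holomorphic $2$-vector on $\mathbb{C}^4\setminus\{0\}$ defined by $$w=\sum_{i,j=0}^{3}\frac{dz_i\wedge dz_j\wedge d\alpha}{dz_0\wedge dz_1\wedge dz_2\wedge dz_3}\,\frac{\partial}{\partial z_i}\wedge\frac{\partial}{\partial z_j}.$$ If $\alpha$ is real, i.e. $\Phi(\alpha)=\alpha$, then $w$ is real, i.e. $\Phi(w)=w$.
   Context: A $1$-form associated with a codimension one holomorphic foliation of degree $2$ on $\mathbb{CP}^3$ is a $1$-form $\alpha=\sum_{i=0}^3 f_i\,dz_i$ on $\mathbb{C}^4\setminus\{0\}$ whose coefficients $f_i$ are homogeneous polynomials of degree $3$ in $z_0,\dots,z_3$, with $\sum_i z_if_i=0$ and $\alpha\wedge d\alpha=0$. For a holomorphic $4$-form $\beta=h\,dz_0\wedge dz_1\wedge dz_2\wedge dz_3$, the quotient $\frac{\beta}{dz_0\wedge dz_1\wedge dz_2\wedge dz_3}$ denotes the function $h$. Let $\boldsymbol{j}:\mathbb{C}^4\setminus\{0\}\to\mathbb{C}^4\setminus\{0\}$ be $\boldsymbol{j}(z_0,z_1,z_2,z_3)=(-\bar z_1,\bar z_0,-\bar z_3,\bar z_2)$. On (complex) differential forms $\theta$ put $\Phi(\theta)=\overline{\boldsymbol{j}^*\theta}$. On complex vector fields $u$ put $\Phi(u)=\overline{d\boldsymbol{j}(u)}$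 (push-forward by the diffeomorphism $\boldsymbol{j}$ followed by complex conjugation), extended to $2$-vectors (sections of the second exterior power of the complexified tangent bundle). These are the real structures on, respectively, the space of $1$-forms with polynomial coefficients of degree $3$ and the space of $\mathbb{C}^*$-invariant holomorphic $2$-vectors on $\mathbb{C}^4\setminus\{0\}$. *)

(* Defs.v *)
From mathcomp Require Import all_boot all_order all_algebra all_fingroup.
From mathcomp Require Import all_classical all_reals all_analysis.
From mathcomp Require Import complex.
(* The notations of [mpoly] clash with those of MathComp-Analysis. *)
From mathcomp.multinomials Require Import -(notations) mpoly.
Import Order.TTheory GRing.Theory Num.Theory.
Import numFieldNormedType.Exports.

Set Implicit Arguments.
Unset Strict Implicit.
Unset Printing Implicit Defensive.

Local Open Scope classical_set_scope.
Local Open Scope ring_scope.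
Local Open Scope complex_scope.

(* C^4 is seen as the real vector space of row vectors (x_0..x_3, y_0..y_3) with
   z_k = x_k + i y_k. Fields and forms on C^4 \ {0} are total functions on this
   space; their values at the origin are irrelevant, and every condition on them
   is only imposed at nonzero points. *)
Notation C4 R := 'rV[R]_(4 + 4).

Section Forms.
Variable R : realType.
Local Notation C := R[i].

Definition zcoord (p : C4 R) (k : 'I_4) : C :=
  p 0 (lshift 4 k) +i* p 0 (rshift 4 k).

Definition of_zcoord (z : 'I_4 -> C) : C4 R :=
  row_mx (\row_k complex.Re (z k)) (\row_k complex.Im (z k)).

Lemma zcoordK (z : 'I_4 -> C) k : zcoord (of_zcoord z) k = z k.
Proof. by rewrite /zcoord row_mxEl row_mxEr !mxE; case: (z k). Qed.

(* A complex k-form: its value at a point is a function of k real tangent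
   vectors, which for genuine forms is R-multilinear and alternating, that is,
   an element of Lambda^k(T^* ) tensored with C. *)
Definition cform (k : nat) := C4 R -> ('I_k -> C4 R) -> C.

Definition cform_eq k (theta eta : cform k) :=
  forall p, p != 0 -> theta p =1 eta p.

Definition cform0 k : cform k := fun _ _ => 0.

Definition cwedge k l (theta : cform k) (eta : cform l) : cform (k + l) :=
  fun p v => (k`! * l`!)%:R^-1 *
    \sum_(s : 'S_(k + l)) (-1) ^+ s *
      (theta p (fun i => v (s (lshift l i))) *
       eta p (fun j => v (s (rshift k j)))).

(* Derivative of a complex-valued function along a real direction. *)
Definition cderive (g : C4 R -> C) (p v : C4 R) : C :=
  'D_v (@complex.Re R \o g) p +i* 'D_v (@complex.Im R \o g) p.

(* Exterior derivative, evaluated on constant vector fields (whose brackets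
   vanish). *)
Definition dext k (theta : cform k) : cform k.+1 :=
  fun p v => \sum_(i < k.+1) (-1) ^+ i *
    cderive (fun q => theta q (fun l => v (lift i l))) p (v i).

Definition dz (k : 'I_4) : cform 1 := fun _ v => zcoord (v 0) k.

Definition dz0123 : cform 4 :=
  cwedge (cwedge (cwedge (dz (inord 0)) (dz (inord 1))) (dz (inord 2)))
    (dz (inord 3)).

(* The function h with beta = h dz_0 /\ dz_1 /\ dz_2 /\ dz_3 (with value 0 at the
   points where there is no such h). *)
Definition quot_dz (beta : cform 4) (p : C4 R) : C :=
  xget 0 [set h : C | forall v, beta p v = h * dz0123 p v].

Definition peval (f : mpoly 4 C) (p : C4 R) : C :=
  meval (zcoord p) f.

Definition poly_form (f : 'I_4 -> mpoly 4 C) : cform 1 :=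
  fun p v => \sum_i peval (f i) p * dz i p v.

Definition foliation_form2 (alpha : cform 1) : Prop :=
  exists f : 'I_4 -> mpoly 4 C,
    [/\ forall i, f i \is ishomog1 3 mdeg,
        cform_eq alpha (poly_form f),
        forall p, p != 0 -> \sum_i zcoord p i * peval (f i) p = 0
      & cform_eq (cwedge alpha (dext alpha)) (@cform0 3)].

(* Complexified tangent vectors are complex row vectors in the basis
   d/dx_0..d/dx_3, d/dy_0..d/dy_3. The second exterior power is identified with
   the skew-symmetric complex matrices, u /\ v being u (x) v - v (x) u. *)
Definition cvector_field := C4 R -> 'rV[C]_(4 + 4).
Definition bivector_field := C4 R -> 'M[C]_(4 + 4).

Definition vwedge (u v : 'rV[C]_(4 + 4)) : 'M[C]_(4 + 4) :=
  u^T *m v - v^T *m u.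

(* d/dz_k = (d/dx_k - i d/dy_k) / 2 *)
Definition ddz (k : 'I_4) : 'rV[C]_(4 + 4) :=
  row_mx (2^-1 *: delta_mx 0 k) (- (0 +i* 2^-1) *: delta_mx 0 k).

Definition w_of (alpha : cform 1) : bivector_field := fun p =>
  \sum_i \sum_j
    quot_dz (cwedge (cwedge (dz i) (dz j)) (dext alpha)) p *:
      vwedge (ddz i) (ddz j).

Definition jmap (p : C4 R) : C4 R :=
  of_zcoord (fun k => [:: - conjc (zcoord p (inord 1)); conjc (zcoord p (inord 0));
                         - conjc (zcoord p (inord 3)); conjc (zcoord p (inord 2))]`_k).

Definition jinv (p : C4 R) : C4 R := - jmap p.

Lemma zcoord_inj (p q : C4 R) : zcoord p =1 zcoord q -> p = q.
Proof.
move=> e; rewrite -[p]hsubmxK -[q]hsubmxK; congr row_mx; apply/rowP => k;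
  by have := e k; rewrite /zcoord !mxE => -[].
Qed.

Lemma zcoordN (p : C4 R) k : zcoord (- p) k = - zcoord p k.
Proof. by rewrite /zcoord !mxE. Qed.

Lemma jmapN (p : C4 R) : jmap (- p) = - jmap p.
Proof.
apply: zcoord_inj => k; rewrite zcoordN !zcoordK.
by case: k => -[|[|[|[|//]]]] ? /=;
  rewrite !mxE; apply/eqP; rewrite eq_complex /= ?opprK !eqxx.
Qed.

Lemma jmap_jmap (p : C4 R) : jmap (jmap p) = - p.
Proof.
apply: zcoord_inj => k.
rewrite zcoordN -[k in RHS]inord_val !zcoordK !inordK //.
by case: k => -[|[|[|[|//]]]] ? /=; apply/eqP; rewrite eq_complex /= ?opprK !eqxx.
Qed.

Lemma jmapK : cancel jmap jinv.
Proof. by move=> p; rewrite /jinv jmap_jmap opprK. Qed.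

Lemma jinvK : cancel jinv jmap.
Proof. by move=> p; rewrite /jinv jmapN jmap_jmap opprK. Qed.

Lemma jmap_eq0 (p : C4 R) : (jmap p == 0) = (p == 0).
Proof.
have j0 : jmap 0 = 0.
  apply: zcoord_inj => k; rewrite zcoordK /zcoord !mxE.
  case: k => -[|[|[|[|//]]]] ? /=; apply/eqP;
    by rewrite eq_complex /= ?mxE ?oppr0 !eqxx.
by apply/eqP/eqP => [e|->//]; rewrite -(jmapK p) e /jinv j0 oppr0.
Qed.

Definition Phi_form k (theta : cform k) : cform k :=
  fun p v => conjc (theta (jmap p) (fun i => 'd jmap p (v i))).

(* Complex-linear extension of the differential of jmap, acting on rows from the
   right. *)
Definition cjacobian (p : C4 R) : 'M[C]_(4 + 4) :=
  map_mx (real_complex R) ('J jmap p).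

Definition Phi_vector (u : cvector_field) : cvector_field :=
  fun q => map_mx conjc (u (jinv q) *m cjacobian (jinv q)).

Definition Phi_bivector (B : bivector_field) : bivector_field :=
  fun q => map_mx conjc
    ((cjacobian (jinv q))^T *m B (jinv q) *m cjacobian (jinv q)).

Lemma Phi_bivector_vwedge (u v : cvector_field) :
  Phi_bivector (fun p => vwedge (u p) (v p)) =
  fun q => vwedge (Phi_vector u q) (Phi_vector v q).
Proof.
apply/funext => q; rewrite /Phi_bivector /Phi_vector /vwedge.
move: (u _) (v _) (cjacobian _) => {}u {}v J.
rewrite mulmxBr mulmxBl raddfB /= !map_mxM /=.
by rewrite !trmx_mul !map_trmx !mulmxA.
Qed.

Definition real_form k (theta : cform k) : Prop :=
  cform_eq (Phi_form theta) theta.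

Definition real_bivector (B : bivector_field) : Prop :=
  forall p, p != 0 -> Phi_bivector B p = B p.

End Forms.

(* Main.v *)
(* Phi commutes with the wedge product and, on smooth forms, with d, so a real
   alpha has a real d alpha. In coordinates j is z_k |-> c_k conj(z_(s k)) with
   c = (-1, 1, -1, 1) and s = (0 1)(2 3); hence Phi(dz_k) = c_k dz_(s k) and
   Phi(d/dz_k) = c_(s k) d/dz_(s k), and dz_0 /\ dz_1 /\ dz_2 /\ dz_3 is real
   because c_0 c_1 c_2 c_3 = 1 and s is even. So the (s i, s j) coefficient of w
   at j(p) is the conjugate of the (i, j) coefficient at p, up to the same signs
   by which Phi acts on d/dz_i /\ d/dz_j, and the sum defining w is permuted. *)

From HB Require Import structures.
From mathcomp Require Import all_boot all_order all_algebra all_fingroup.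
From mathcomp Require Import all_classical all_reals all_analysis.
From mathcomp Require Import complex.
From mathcomp.multinomials Require Import -(notations) mpoly.
Require Import Defs.
Import Order.TTheory GRing.Theory Num.Theory.
Import numFieldNormedType.Exports.

Set Implicit Arguments.
Unset Strict Implicit.
Unset Printing Implicit Defensive.

Local Open Scope classical_set_scope.
Local Open Scope ring_scope.
Local Open Scope complex_scope.

(** * Preliminaries: continuity of linear maps, and determinants as sums over permutations *)

Lemma linear_rV_continuous (R : realType) n (V : normedModType R)
  (f : {linear 'rV[R]_n -> V}) : continuous f.
Proof.
move=> v; apply: differentiable_continuous.
(* In finite dimension a linear map is a finite sum of coordinates times fixed vectors. *)
pose g k (u : 'rV[R]_n) := u 0 k *: f (delta_mx 0 k).
rewrite (_ : f = \sum_(k < n) g k :> (_ -> _)).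
  apply: differentiable_sum => k.
  exact/differentiableZl/differentiable_coord.
apply/funext => u; rewrite fct_sumE [in LHS](row_sum_delta u) linear_sum.
by apply: eq_bigr => k _; rewrite linearZ.
Qed.

Lemma lift_perm_addn1 k (t : 'S_k) : exists u : 'S_(k + 1),
  [/\ forall i, u (lshift 1 i) = lshift 1 (t i),
      u (rshift k ord0) = rshift k ord0 & odd_perm u = odd_perm t].
Proof.
have e := esym (addn1 k).
exists (cast_perm e (lift_perm ord_max ord_max t)); split=> [i||].
- apply/val_inj; rewrite cast_permE /=.
  have -> : cast_ord (esym e) (lshift 1 i) = lift ord_max i.
    by apply/val_inj; rewrite /= /bump leqNgt ltn_ord.
  by rewrite lift_perm_lift /= /bump leqNgt ltn_ord.
- apply/val_inj; rewrite cast_permE /=.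
  have -> : cast_ord (esym e) (rshift k ord0) = ord_max.
    by apply/val_inj; rewrite /= addn0.
  by rewrite lift_perm_id /= addn0.
- suff -> : odd_perm (cast_perm e (lift_perm ord_max ord_max t)) =
            odd_perm (lift_perm ord_max ord_max t).
    by rewrite odd_lift_perm addbb.
  by case: _ / e.
Qed.

(** This sum is what [cwedge] produces from a determinantal [k]-form and a [1]-form; the factor [k!]
    is the overcount that its normalisation removes. *)
Lemma sum_perm_det_col_mx (R : comPzRingType) k (A : 'M[R]_(k, k + 1))
    (b : 'rV[R]_(k + 1)) :
  \sum_(s : 'S_(k + 1)) (-1) ^+ s *
    (\det (colsub (fun j => s (lshift 1 j)) A) * b 0 (s (rshift k ord0))) =
  k`!%:R * \det (col_mx A b).
Proof.
pose G (s : 'S_(k + 1)) :=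
  (\prod_i A i (s (lshift 1 i))) * b 0 (s (rshift k ord0)).
have -> : \det (col_mx A b) = \sum_(s : 'S_(k + 1)) (-1) ^+ s * G s.
  apply: eq_bigr => s _; congr (_ * _); rewrite big_split_ord big_ord1 /=.
  rewrite col_mxEd; congr (_ * _).
  by apply: eq_bigr => i _; rewrite col_mxEu.
(* Each t in the expansion of the small determinant contributes the same amount:
   reindex s along the extension of t fixing the last index. *)
under eq_bigr do rewrite mulr_suml mulr_sumr.
rewrite exchange_big /= -(card_Sn k) mulr_natl -sumr_const.
apply: eq_big => [t|t _]; first by rewrite inE.
have [u [ul ur oddu]] := lift_perm_addn1 t.
rewrite [RHS](reindex_inj (mulgI u)); apply: eq_bigr => s _ /=.
rewrite odd_permM oddu signr_addb /G permM ur.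
rewrite -!mulrA mulrCA; congr (_ * (_ * (_ * _))).
by apply: eq_bigr => i _; rewrite mxE permM ul.
Qed.

(** * Conjugation, and the map j in coordinates *)

Section Quaternionic.
Variable R : realType.
Local Notation C := R[i].
Implicit Types (p q : C4 R) (g : C4 R -> C).

Lemma conjcD (x y : C) : conjc (x + y) = conjc x + conjc y.
Proof. exact: (rmorphD (@conjc R)). Qed.

Lemma conjcM (x y : C) : conjc (x * y) = conjc x * conjc y.
Proof. exact: (rmorphM (@conjc R)). Qed.

Lemma conjc_sum (I : Type) (r : seq I) (P : pred I) (F : I -> C) :
  conjc (\sum_(i <- r | P i) F i) = \sum_(i <- r | P i) conjc (F i).
Proof. exact: (rmorph_sum (@conjc R)). Qed.

Lemma conjc_sign n : conjc ((-1) ^+ n : C) = (-1) ^+ n.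
Proof. exact: (rmorph_sign (@conjc R)). Qed.

Definition jperm : 'S_4 :=
  (tperm (@Ordinal 4 0 isT) (@Ordinal 4 1 isT) *
   tperm (@Ordinal 4 2 isT) (@Ordinal 4 3 isT))%g.


(** The ring is a parameter because these signs scale both real tangent vectors and complex
    coefficients; [jsign_complex] links the two uses. *)
Definition jsign (S : pzRingType) (k : 'I_4) : S := (-1) ^+ ~~ odd k.
Arguments jsign {S}.

Lemma val_jperm (k : 'I_4) : (jperm k = nth 0 [:: 1; 0; 3; 2] k :> nat)%N.
Proof. by rewrite permM !permE /=; case: k => -[|[|[|[|//]]]]. Qed.

Lemma jpermK : involutive jperm.
Proof.
by move=> k; apply/val_inj; rewrite /= !val_jperm; case: k => -[|[|[|[|//]]]].
Qed.


Lemma odd_perm_jperm : odd_perm jperm = false.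
Proof. by rewrite odd_permM !odd_tperm. Qed.

Lemma zcoord_jmap p k :
  zcoord (jmap p) k = jsign k * conjc (zcoord p (jperm k)).
Proof.
rewrite zcoordK /jsign -(inord_val (jperm k)) val_jperm.
by case: k => -[|[|[|[|//]]]] k4 /=; rewrite ?mulN1r ?mul1r.
Qed.

Lemma zcoordP a p q k : zcoord (a *: p + q) k = a%:C * zcoord p k + zcoord q k.
Proof. by rewrite /zcoord !mxE; simpc. Qed.

Lemma jmap_linear : linear (@jmap R).
Proof.
move=> a p q; apply: zcoord_inj => k.
by rewrite zcoordP !zcoord_jmap zcoordP conjcD conjcM conjc_real mulrDr mulrCA.
Qed.

HB.instance Definition _ :=
  GRing.isLinear.Build R (C4 R) (C4 R) _ (@jmap R) jmap_linear.

Lemma diff_jmap p : 'd (@jmap R) p = @jmap R :> (_ -> _).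
Proof. exact/diff_lin/linear_rV_continuous. Qed.

(** * Phi on wedge products and on the dz_k *)

Lemma Phi_formE k (theta : cform R k) p v :
  Phi_form theta p v = conjc (theta (jmap p) (fun i => jmap (v i))).
Proof. by rewrite /Phi_form diff_jmap. Qed.

Lemma Phi_form_wedge k l (theta : cform R k) (eta : cform R l) :
  Phi_form (cwedge theta eta) = cwedge (Phi_form theta) (Phi_form eta).
Proof.
apply/funext => p; apply/funext => v.
rewrite Phi_formE /cwedge conjcM conjc_inv conjc_nat conjc_sum; congr (_ * _).
by apply: eq_bigr => s _; rewrite !conjcM conjc_sign !Phi_formE.
Qed.

Lemma Phi_form_dz k :
  Phi_form (@dz R k) = fun p v => jsign k * dz (jperm k) p v.
Proof.
apply/funext => p; apply/funext => v.
by rewrite Phi_formE /dz zcoord_jmap conjcM conjc_sign conjcK.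
Qed.

Lemma cwedgeZl k l c (theta : cform R k) (eta : cform R l) :
  cwedge (fun p v => c * theta p v) eta = fun p v => c * cwedge theta eta p v.
Proof.
apply/funext => p; apply/funext => v.
rewrite /cwedge mulrCA; congr (_ * _); rewrite mulr_sumr.
by apply: eq_bigr => s _; rewrite -mulrA mulrCA.
Qed.

Lemma cwedgeZr k l c (theta : cform R k) (eta : cform R l) :
  cwedge theta (fun p v => c * eta p v) = fun p v => c * cwedge theta eta p v.
Proof.
apply/funext => p; apply/funext => v.
rewrite /cwedge mulrCA; congr (_ * _); rewrite mulr_sumr.
by apply: eq_bigr => s _; rewrite [RHS]mulrCA; congr (_ * _); exact: mulrCA.
Qed.

(** * Wedges of the dz_k as determinants, and the volume form *)

Definition zdet k (f : 'I_k -> 'I_4) : cform R k :=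
  fun _ v => \det (\matrix_(i, j) zcoord (v j) (f i)).

Lemma dz_zdet k : dz k = zdet (fun _ : 'I_1 => k).
Proof.
by apply/funext => p; apply/funext => v; rewrite /zdet det_mx11 mxE.
Qed.

Lemma cwedge_zdet k (f : 'I_(k + 1) -> 'I_4) :
  cwedge (zdet (fun i => f (lshift 1 i))) (dz (f (rshift k ord0))) = zdet f.
Proof.
apply/funext => p; apply/funext => v.
pose A := \matrix_(i < k, j < k + 1) zcoord (v j) (f (lshift 1 i)).
pose b := \row_(j < k + 1) zcoord (v j) (f (rshift k ord0)).
rewrite /cwedge muln1.
transitivity (k`!%:R^-1 * (k`!%:R * \det (col_mx A b))).
  rewrite -sum_perm_det_col_mx; congr (_ * _); apply: eq_bigr => s _.
  rewrite /dz mxE; congr (_ * (\det _ * _)).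
  by apply/matrixP => i j; rewrite !mxE.
rewrite mulKf ?pnatr_eq0 -?lt0n ?fact_gt0 //; congr (\det _).
by apply/matrixP => i j; rewrite !mxE; case: splitP => i' e;
  rewrite mxE; congr (zcoord _ (f _)); apply/val_inj; rewrite /= e // ord1.
Qed.

Lemma dz0123E p v : dz0123 p v = \det (\matrix_(i, j) zcoord (v j) i).
Proof.
rewrite /dz0123 (dz_zdet (inord 0)).
(* With [inord], one formula indexes the partial wedges for all [n], so [fS] adds the factors one at
   a time. *)
pose f n (i : 'I_n) : 'I_4 := inord i.
have fS n : cwedge (zdet (@f n)) (dz (inord n)) = zdet (@f (n + 1)).
  rewrite -(cwedge_zdet (@f (n + 1))) /f /=.
  by rewrite addn0.
have -> : zdet (fun _ : 'I_1 => inord 0) = zdet (@f 1).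
  by congr zdet; apply/funext => i; rewrite ord1.
rewrite !fS; congr (\det _).
by apply/matrixP => i j; rewrite !mxE /f inord_val.
Qed.

Lemma dz0123_neq0 p : exists v, dz0123 p v != 0.
Proof.
(* These are the vectors d/dx_j, on which the matrix of the dz_i is the identity. *)
exists (fun j => of_zcoord (fun k => (k == j)%:R)).
rewrite dz0123E (_ : \matrix_(i, j) _ = 1%:M) ?det1 ?oner_eq0 //.
by apply/matrixP => i j; rewrite mxE zcoordK mxE.
Qed.

Lemma Phi_form_dz0123 : Phi_form (@dz0123 R) = @dz0123 R.
Proof.
apply/funext => p; apply/funext => v; rewrite Phi_formE !dz0123E.
rewrite -(det_map_mx (@conjc R)).
set Z := \matrix_(i, j) zcoord (v j) i.
(* The conjugations cancel: what is left is [Z] with rows permuted by [jperm] and scaled by the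
   signs, and both of these operations have determinant 1. *)
rewrite (_ : map_mx _ _ = diag_mx (\row_i jsign i) *m row_perm jperm Z).
  rewrite det_mulmx det_diag row_permE det_mulmx det_perm odd_perm_jperm !mul1r.
  rewrite (_ : \prod_i _ = 1) ?mul1r //.
  rewrite !big_ord_recl big_ord0 !mxE /jsign /=.
  by rewrite !expr1 !expr0 !mulN1r !mul1r opprK.
apply/matrixP => i j; rewrite mul_diag_mx !mxE zcoord_jmap.
by rewrite [LHS]conjcM conjc_sign conjcK.
Qed.

(** * The quotient by the volume form *)

Lemma quot_dz_eq (beta : cform R 4) p h :
  (forall v, beta p v = h * dz0123 p v) -> quot_dz beta p = h.
Proof.
move=> hP; apply: xget_unique => // h' h'P.
have [v v0] := dz0123_neq0 p.
by apply: (mulIf v0); rewrite -h'P.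
Qed.

Lemma quot_dz_none (beta : cform R 4) p :
  (forall h, ~ forall v, beta p v = h * dz0123 p v) -> quot_dz beta p = 0.
Proof. exact: xgetPN. Qed.

Lemma quot_dzZ c (beta : cform R 4) p : c != 0 ->
  quot_dz (fun p v => c * beta p v) p = c * quot_dz beta p.
Proof.
move=> c0.
have [[h hP]|nex] := pselect (exists h, forall v, beta p v = h * dz0123 p v).
  by rewrite (quot_dz_eq hP); apply: quot_dz_eq => v; rewrite hP mulrA.
rewrite (quot_dz_none (beta := beta)) ?mulr0; last first.
  by move=> h hP; apply: nex; exists h.
(* Dividing by [c] turns a quotient of [c * beta] into one of [beta], so both sides take the default
   value 0 together. *)
apply: quot_dz_none => h hP; apply: nex; exists (c^-1 * h) => v.
by rewrite -mulrA -hP mulKf.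
Qed.

(* Where beta is not a multiple of dz0123 both sides take the default value 0,
   so the quotient need not be shown to exist. *)
Lemma quot_dz_Phi (beta : cform R 4) p :
  quot_dz (Phi_form beta) p = conjc (quot_dz beta (jmap p)).
Proof.
have dzj v : dz0123 (jmap p) (fun i => jmap (v i)) = conjc (dz0123 p v).
  by rewrite -[in RHS]Phi_form_dz0123 Phi_formE conjcK.
have [[h hP]|nex] :=
    pselect (exists h, forall v, beta (jmap p) v = h * dz0123 (jmap p) v).
  rewrite (quot_dz_eq hP); apply: quot_dz_eq => v.
  by rewrite Phi_formE hP conjcM dzj conjcK.
rewrite (quot_dz_none (beta := beta)) ?conjc0; last first.
  by move=> h hP; apply: nex; exists h.
apply: quot_dz_none => h hP; apply: nex; exists (conjc h) => v.
(* As j is onto, every tuple [v] has the form j(u), so a quotient of [Phi_form beta] at [p] yields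
   one of [beta] at j(p). *)
have vE : v = (fun i => jmap (jinv (v i))) by apply/funext => i; rewrite jinvK.
have := hP (fun i => jinv (v i)); rewrite Phi_formE -vE => e.
by rewrite -[LHS]conjcK e conjcM [in RHS]vE dzj.
Qed.

(** * Real differentiability of complex-valued functions and polynomial forms *)

Definition cdifferentiable g p :=
  differentiable (@complex.Re R \o g) p /\
  differentiable (@complex.Im R \o g) p.

Lemma cdifferentiable_cst c p : cdifferentiable (fun _ => c) p.
Proof. by split; exact: differentiable_cst. Qed.

Lemma cdifferentiable_zcoord k p : cdifferentiable (fun q => zcoord q k) p.
Proof. by split; exact: differentiable_coord. Qed.

Lemma cdifferentiableD g h p : cdifferentiable g p -> cdifferentiable h p ->
  cdifferentiable (fun q => g q + h q) p.
Proof.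
move=> [gr gi] [hr hi]; split.
- rewrite (_ : _ \o _ = (@complex.Re R \o g) + (@complex.Re R \o h)).
    exact: differentiableD.
  by apply/funext => q /=; rewrite fctE /=; case: (g q); case: (h q).
- rewrite (_ : _ \o _ = (@complex.Im R \o g) + (@complex.Im R \o h)).
    exact: differentiableD.
  by apply/funext => q /=; rewrite fctE /=; case: (g q); case: (h q).
Qed.

Lemma cdifferentiableM g h p : cdifferentiable g p -> cdifferentiable h p ->
  cdifferentiable (fun q => g q * h q) p.
Proof.
move=> [gr gi] [hr hi]; split.
- rewrite (_ : _ \o _ = (@complex.Re R \o g) * (@complex.Re R \o h)
                      - (@complex.Im R \o g) * (@complex.Im R \o h)).
    by apply: differentiableB; exact: differentiableM.
  by apply/funext => q /=; rewrite !fctE /=; case: (g q); case: (h q).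
- rewrite (_ : _ \o _ = (@complex.Re R \o g) * (@complex.Im R \o h)
                      + (@complex.Im R \o g) * (@complex.Re R \o h)).
    by apply: differentiableD; exact: differentiableM.
  by apply/funext => q /=; rewrite !fctE /=; case: (g q); case: (h q).
Qed.

Lemma cdifferentiable_sum (I : Type) (r : seq I) (F : I -> C4 R -> C) p :
  (forall i, cdifferentiable (F i) p) ->
  cdifferentiable (fun q => \sum_(i <- r) F i q) p.
Proof.
move=> dF; elim: r => [|i r IH].
  by under eq_fun do rewrite big_nil; exact: cdifferentiable_cst.
by under eq_fun do rewrite big_cons; exact: cdifferentiableD.
Qed.

Lemma cdifferentiable_prod (I : Type) (r : seq I) (F : I -> C4 R -> C) p :
  (forall i, cdifferentiable (F i) p) ->
  cdifferentiable (fun q => \prod_(i <- r) F i q) p.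
Proof.
move=> dF; elim: r => [|i r IH].
  by under eq_fun do rewrite big_nil; exact: cdifferentiable_cst.
by under eq_fun do rewrite big_cons; exact: cdifferentiableM.
Qed.

Lemma cdifferentiable_peval f p : cdifferentiable (@peval R f) p.
Proof.
rewrite /peval; under eq_fun do rewrite mevalE.
apply: cdifferentiable_sum => m; apply: cdifferentiableM.
  exact: cdifferentiable_cst.
apply: cdifferentiable_prod => i; elim: (m i) => [|n IH].
  exact: cdifferentiable_cst.
under eq_fun do rewrite exprS; apply: cdifferentiableM => //.
exact: cdifferentiable_zcoord.
Qed.

Lemma cdifferentiable_poly_form f v p :
  cdifferentiable (fun q => @poly_form R f q v) p.
Proof.
apply: cdifferentiable_sum => i; apply: cdifferentiableM.
  exact: cdifferentiable_peval.
exact: cdifferentiable_cst.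
Qed.

(** * Phi and the exterior derivative *)

Lemma cderive_jmap g p v :
  cderive (fun q => g (jmap q)) p v = cderive g (jmap p) (jmap v).
Proof.
(* By linearity of j the difference quotients on the two sides coincide, so no differentiability of
   [F] is involved. *)
have E (F : C4 R -> R) : 'D_v (fun q => F (jmap q)) p = 'D_(jmap v) F (jmap p).
  by rewrite /derive; under eq_fun do rewrite /= jmap_linear.
by rewrite /cderive; congr (_ +i* _); exact: E.
Qed.

Lemma cderive_conjc g p v : cdifferentiable g p ->
  cderive (fun q => conjc (g q)) p v = conjc (cderive g p v).
Proof.
move=> [_ gi]; rewrite /cderive /=; congr (_ +i* _).
  by congr ('D_v _ p); apply/funext => q /=; case: (g q).
rewrite -deriveN; last exact: diff_derivable.
by congr ('D_v _ p); apply/funext => q /=; rewrite fctE /=; case: (g q).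
Qed.

(** As j is linear, it sends constant vector fields to constant ones, so the two formulas for d
    agree term by term; differentiability lets conjugation pass through each derivative. *)
Lemma Phi_form_dext k (theta : cform R k) p :
  (forall v, cdifferentiable (fun q => theta q v) (jmap p)) ->
  Phi_form (dext theta) p = dext (Phi_form theta) p.
Proof.
move=> dtheta; apply/funext => v; rewrite Phi_formE /dext conjc_sum.
apply: eq_bigr => i _; rewrite conjcM conjc_sign; congr (_ * _).
under [in RHS]eq_fun do rewrite Phi_formE.
by rewrite (cderive_jmap (fun q => conjc (theta q _))) cderive_conjc.
Qed.

Lemma near_neq0 p : p != 0 -> \forall q \near p, q != 0.
Proof.
move=> p0; apply: open_nbhs_nbhs; split => //.
rewrite (_ : (fun q => _) = ~` [set 0]); last first.
  by apply/funext => q; apply/propext; split => /eqP.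
apply/closed_openC/accessible_closed_set1.
exact/hausdorff_accessible/norm_hausdorff.
Qed.

(** Derivatives at [p] see only a neighbourhood of [p], which can be taken to avoid the origin. *)
Lemma dext_eq k (theta eta : cform R k) p :
  cform_eq theta eta -> p != 0 -> dext theta p = dext eta p.
Proof.
move=> e p0; apply/funext => v; rewrite /dext; apply: eq_bigr => i _.
by rewrite /cderive; congr (_ * (_ +i* _)); apply: near_eq_derive;
  near=> q => /=; rewrite e //; near: q; exact: near_neq0.
Unshelve. all: by end_near. Qed.

Lemma Phi_form_eq k (theta eta : cform R k) :
  cform_eq theta eta -> cform_eq (Phi_form theta) (Phi_form eta).
Proof. by move=> e p p0 v; rewrite !Phi_formE e // jmap_eq0. Qed.

(** The differentiability needed to commute Phi with d comes from the polynomial form that [alpha]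
    equals off the origin; [dext_eq] passes between the two. *)
Lemma real_form_dext alpha p : foliation_form2 alpha -> @real_form R 1 alpha ->
  p != 0 -> Phi_form (dext alpha) p = dext alpha p.
Proof.
move=> [f [_ alphaE _ _]] realalpha p0.
have -> : Phi_form (dext alpha) p = Phi_form (dext (poly_form f)) p.
  apply/funext => v; rewrite !Phi_formE (dext_eq alphaE) ?jmap_eq0 //.
rewrite Phi_form_dext; last by move=> v; exact: cdifferentiable_poly_form.
apply: dext_eq => // q q0 v.
by rewrite -(realalpha q q0 v); apply/esym/Phi_form_eq.
Qed.

(** * The coefficients of w at j(p) *)

Lemma quot_dz_jmap alpha p i j : foliation_form2 alpha -> real_form alpha ->
  p != 0 ->
  quot_dz (cwedge (cwedge (dz i) (dz j)) (dext alpha)) (jmap p) =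
  jsign i * jsign j *
  conjc (quot_dz
    (cwedge (cwedge (dz (jperm i)) (dz (jperm j))) (dext alpha)) p).
Proof.
move=> fol re p0; rewrite -[LHS]conjcK -quot_dz_Phi.
pose beta := cwedge (cwedge (dz (jperm i)) (dz (jperm j))) (dext alpha).
pose c : C := jsign i * jsign j.
have Eij : cwedge (Phi_form (dz i)) (Phi_form (dz j)) =
    fun p v => c * cwedge (dz (jperm i)) (dz (jperm j)) p v.
  rewrite !Phi_form_dz cwedgeZl; apply/funext => r; apply/funext => v.
  by rewrite (cwedgeZr (jsign j) (dz (jperm i)) (dz (jperm j))) mulrA.
(* An equality at the single point [p] is enough, since [quot_dz] reads a form only there; realness
   of d alpha is available only off the origin. *)
have E : Phi_form (k := 1 + 1 + 2)
      (cwedge (cwedge (dz i) (dz j)) (dext alpha)) p =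
    fun v => c * beta p v.
  by rewrite !Phi_form_wedge Eij cwedgeZl /beta /cwedge real_form_dext.
transitivity (conjc (c * quot_dz beta p)); last first.
  by rewrite /c !conjcM !conjc_sign.
rewrite -quot_dzZ; last by rewrite mulf_neq0 // signr_eq0.
by rewrite /quot_dz E.
Qed.

(** * Phi on the vector fields d/dz_k *)

Lemma cjacobianE p : cjacobian p = map_mx (real_complex R) (lin1_mx (@jmap R)).
Proof.
rewrite /cjacobian /derive.jacobian; congr map_mx.
by apply/matrixP => i j; rewrite [LHS]mxE [RHS]mxE diff_jmap.
Qed.

Lemma zcoord_row_mx (a b : 'rV[R]_4) k :
  zcoord (row_mx a b) k = a 0 k +i* b 0 k.
Proof. by rewrite /zcoord row_mxEl row_mxEr. Qed.

Lemma jsign_complex k : jsign k = (jsign k)%:C :> C.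
Proof. exact/esym/(rmorph_sign (real_complex R)). Qed.

Lemma jmap_ddx (k : 'I_4) :
  jmap (row_mx (delta_mx 0 k) 0) =
  jsign (jperm k) *: row_mx (delta_mx 0 (jperm k)) 0 :> C4 R.
Proof.
apply: zcoord_inj => i; rewrite zcoord_jmap scale_row_mx !zcoord_row_mx !mxE /=.
rewrite jsign_complex (inv_eq jpermK).
by case: eqVneq => [->|_]; simpc; rewrite ?jpermK ?mulr0 ?mulr1 ?oppr0.
Qed.

(** The minus sign, absent for d/dx_k, reflects that j is conjugate-linear. *)
Lemma jmap_ddy (k : 'I_4) :
  jmap (row_mx 0 (delta_mx 0 k)) =
  - jsign (jperm k) *: row_mx 0 (delta_mx 0 (jperm k)) :> C4 R.
Proof.
apply: zcoord_inj => i; rewrite zcoord_jmap scale_row_mx !zcoord_row_mx !mxE /=.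
rewrite jsign_complex (inv_eq jpermK).
by case: eqVneq => [->|_]; simpc; rewrite ?jpermK ?mulr0 ?mulr1 ?oppr0.
Qed.

(** Separating complex scalars from real vectors lets the Jacobian act through j on the vectors, and
    conjugation affect only the scalars. *)
Lemma ddzE k : ddz R k =
  2^-1 *: (map_mx (real_complex R) (row_mx (delta_mx 0 k) 0)
           - 'i%C *: map_mx (real_complex R) (row_mx 0 (delta_mx 0 k))).
Proof.
have half : (0 +i* 2^-1 : C) = 2^-1 * 'i%C.
  have -> : 2^-1 = (2^-1 : R)%:C by rewrite [RHS]fmorphV rmorph_nat.
  by simpc.
rewrite /ddz !map_row_mx !map_delta_mx !map_mx0 scale_row_mx opp_row_mx.
rewrite add_row_mx scale_row_mx; congr row_mx.
  by rewrite scaler0 oppr0 addr0.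
by rewrite add0r scalerN scalerA -half scaleNr.
Qed.

Lemma Phi_vector_ddz k q :
  Phi_vector (fun _ => ddz R k) q = jsign (jperm k) *: ddz R (jperm k).
Proof.
rewrite /Phi_vector ddzE cjacobianE.
rewrite -scalemxAl mulmxBl -scalemxAl -!map_mxM !mul_rV_lin1 /=.
rewrite jmap_ddx jmap_ddy ddzE !(map_mxZ (real_complex R)).
set x := map_mx _ (row_mx _ 0); set y := map_mx _ (row_mx 0 _).
have cx : map_mx conjc x = x.
  by apply/matrixP => i j; rewrite !mxE; exact: conjc_real.
have cy : map_mx conjc y = y.
  by apply/matrixP => i j; rewrite !mxE; exact: conjc_real.
rewrite (map_mxZ (@conjc R)) map_mxB !(map_mxZ (@conjc R)) cx cy.
have cs r : @conjc R ((real_complex R) r) = (real_complex R) r.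
  exact: conjc_real.
have half : @conjc R 2^-1 = 2^-1 by rewrite conjc_inv conjc_nat.
have ci : @conjc R 'i%C = - 'i%C by simpc.
(* The sign from conjugating ['i] cancels the one from [jmap_ddy], so the result is again of type
   d/dz and not d/dz-bar. *)
transitivity
  (2^-1 *: (jsign (jperm k) *: x - - 'i%C *: (- jsign (jperm k) *: y))).
  congr (_ *: (_ *: _ - _ *: (_ *: _))); first exact: half.
  - by rewrite jsign_complex; exact: cs.
  - exact: ci.
  - by rewrite jsign_complex -(rmorphN (real_complex R)); exact: cs.
rewrite scaleNr opprK scaleNr scalerN scalerA [_ * jsign _]mulrC.
rewrite -scalerA -scalerBr.
by rewrite !scalerA mulrC.
Qed.

Lemma vwedgeZ a b u v : vwedge (a *: u) (b *: v) = (a * b) *: @vwedge R u v.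
Proof.
rewrite /vwedge !linearZ /= -!scalemxAl !scalerA [b * a]mulrC scalerBr.
by rewrite scalerN scalerA.
Qed.

End Quaternionic.

Theorem theorem1p3 (R : realType) (alpha : cform R 1) :
  foliation_form2 alpha -> real_form alpha -> real_bivector (w_of alpha).
Proof.
move=> fol re q q0.
have [p qE] : exists p, q = jmap p by exists (jinv q); rewrite jinvK.
have p0 : p != 0 by rewrite qE jmap_eq0 in q0.
rewrite /Phi_bivector /w_of.
have -> : jinv q = p by rewrite qE jmapK.
rewrite mulmx_sumr mulmx_suml map_mx_sum.
(* Reindexing both sums by [jperm] pairs the image of the (i, j) term at [p] with the (s i, s j)
   term at j(p). *)
rewrite [RHS](reindex_inj (@perm_inj _ jperm)); apply: eq_bigr => i _ /=.
rewrite mulmx_sumr mulmx_suml map_mx_sum.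
rewrite [RHS](reindex_inj (@perm_inj _ jperm)); apply: eq_bigr => j _ /=.
rewrite qE quot_dz_jmap // !jpermK.
rewrite -scalemxAr -scalemxAl map_mxZ.
have := congr1 (fun f => f (jmap p))
  (Phi_bivector_vwedge (fun _ => ddz R i) (fun _ => ddz R j)).
rewrite {1}/Phi_bivector jmapK /= => ->.
(* The signs from the two vectors are those already produced by [quot_dz_jmap]. *)
by rewrite !Phi_vector_ddz vwedgeZ scalerA mulrC.
Qed.
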